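(* For each integer $r\ge 0$, $$|\mathrm{ASM}(3,r)|=\binom{r+2}{4}+2\binom{r+3}{4}+\binom{r+4}{4}.$$
   Context: For an integer $r\ge 0$, $\mathrm{ASM}(3,r)$ (the higher spin alternating sign matrices of size $3$ with line sum $r$) is the set of $3\times 3$ integer matrices $A=(A_{ij})$ such that all of the following hold: - $\sum_{j'=1}^3 A_{ij'}=\sum_{i'=1}^3 A_{i'j}=r$ for all $1\le i,j\le 3$; - $\sum_{j'=1}^{j}A_{ij'}\ge 0$ for all $1\le i\le 3$, $1\le j\le 2$; - $\sum_{j'=j}^{3}A_{ij'}\ge 0$ for all $1\le i\le 3$, $2\le j\le 3$; - $\sum_{i'=1}^{i}A_{i'j}\ge 0$ for all $1\le i\le 2$, $1\le j\le 3$; - $\sum_{i'=i}^{3}A_{i'j}\ge 0$ for all $2\le i\le 3$, $1\le j\le 3$. *)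

(* Defs.v *)
From mathcomp Require Import all_boot all_order all_algebra.
From mathcomp Require Import boolp classical_sets functions cardinality.

Set Implicit Arguments.
Unset Strict Implicit.
Unset Printing Implicit Defensive.

Local Open Scope ring_scope.
Local Open Scope classical_set_scope.

(* Higher spin alternating sign matrices of size 3 with line sum r.  Rows and
   columns are indexed by 'I_3 = {0, 1, 2}, so that the bounds 1 <= j <= 2 and
   2 <= j <= 3 on 1-based indices become j < 2 and 0 < j. *)
Definition ASM3 (r : nat) : set 'M[int]_3 :=
  [set A : 'M[int]_3 |
    [/\ forall i j : 'I_3, \sum_(j' < 3) A i j' = r%:Z /\
                           \sum_(i' < 3) A i' j = r%:Z,
        forall i j : 'I_3, (j < 2)%N -> 0 <= \sum_(j' < 3 | (j' <= j)%N) A i j',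
        forall i j : 'I_3, (0 < j)%N -> 0 <= \sum_(j' < 3 | (j <= j')%N) A i j',
        forall i j : 'I_3, (i < 2)%N -> 0 <= \sum_(i' < 3 | (i' <= i)%N) A i' j
      & forall i j : 'I_3, (0 < i)%N -> 0 <= \sum_(i' < 3 | (i <= i')%N) A i' j]].

(* Main.v *)
Require Import Defs.
From mathcomp Require Import all_boot all_order all_algebra.
From mathcomp Require Import boolp classical_sets functions cardinality.
From mathcomp Require Import zify.

Import GRing.Theory.

(* A matrix in ASM(3, r) is determined by its corners, and four nonnegative
   integers occur as corners exactly when any two cyclically adjacent ones have
   sum at most r: the first and last rows and columns of A are nonnegative, and
   the remaining inequalities follow from that. Writing the antidiagonal corners
   as r - x and r - y, the diagonal ones range independently over
   0, ..., min(x, y), so there are sum_{0 <= x, y <= r} (min(x, y) + 1)^2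
   matrices. *)

Local Open Scope card_scope.
Local Open Scope classical_set_scope.

(** Each square is ['C(k, 2) + 'C(k.+1, 2)], and both halves sum by the hockey-stick identity. *)
Lemma sum_sqrn n :
  (\sum_(i < n) i.+1 ^ 2 = 'C(n.+1, 3) + 'C(n.+2, 3))%N.
Proof.
elim: n => [|n IHn]; first by rewrite big_ord0.
have bin2 m : ('C(m.+1, 2) = 'C(m, 2) + m)%N by rewrite binS bin1 addnC.
have sq : ('C(n.+1, 2) + 'C(n.+2, 2) = n.+1 ^ 2)%N.
  by elim: n {IHn} => // n; rewrite !bin2; lia.
by rewrite big_ord_recr /= IHn (binS n.+2 2) (binS n.+1 2) -sq; lia.
Qed.

(** Passing from [n] to [n.+1] adds an L-shaped border: two arms, each summing to the value in
    [sum_sqrn n], and the corner [n.+1 ^ 2]. *)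
Lemma sum_minn_sqr n :
  (\sum_(x < n) \sum_(y < n) (minn x y).+1 ^ 2 =
   'C(n.+1, 4) + 2 * 'C(n.+2, 4) + 'C(n.+3, 4))%N.
Proof.
elim: n => [|n IHn]; first by rewrite big_ord0.
rewrite big_ord_recr /=.
under eq_bigr => x _.
  rewrite big_ord_recr /= (minn_idPl (ltnW (ltn_ord x))); over.
rewrite big_split /= IHn big_ord_recr /= minnn sum_sqrn.
under eq_bigr => y _ do rewrite (minn_idPr (ltnW (ltn_ord y))).
(* This expresses the corner square through binomials; Pascal's rule does the rest. *)
have := sum_sqrn n.+1; rewrite big_ord_recr /= sum_sqrn.
rewrite (binS n.+3 3) (binS n.+2 3) (binS n.+1 3); lia.
Qed.

Lemma card_ord_leq n m : (m < n)%N -> #|[set i : 'I_n | (i <= m)%N]%SET| = m.+1.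
Proof.
move=> ltmn.
by rewrite -sum1dep_card -(big_ord_widen n (fun=> 1%N) ltmn) sum1_card card_ord.
Qed.

Lemma card_eq_finset (T : finType) (S : {set T}) : [set` S] #= `I_#|S|.
Proof.
have -> : [set` S] = range (@enum_val T (mem S)).
  apply/seteqP; split=> [x xS | _ [i _ <-]]; last exact: enum_valP.
  by exists (enum_rank_in xS x) => //; rewrite enum_rankK_in.
rewrite (card_eql (inj_card_eq _)) 1?card_eq_sym ?card_II //.
by move=> i j _ _; apply: enum_val_inj.
Qed.

(* The quadruple ((x, y), (a, w)) stands for the matrix with corners
   a, r - x, r - y, w. *)
Definition corners r : {set 'I_r.+1 * 'I_r.+1 * ('I_r.+1 * 'I_r.+1)} :=
  [set q : 'I_r.+1 * 'I_r.+1 * ('I_r.+1 * 'I_r.+1) |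
    (q.2.1 <= minn q.1.1 q.1.2)%N & (q.2.2 <= minn q.1.1 q.1.2)%N]%SET.

Lemma card_corners r :
  #|corners r| = ('C(r + 2, 4) + 2 * 'C(r + 3, 4) + 'C(r + 4, 4))%N.
Proof.
rewrite addn2 addn3 addn4 -sum_minn_sqr pair_big /= -sum1dep_card.
pose le_min (p : 'I_r.+1 * 'I_r.+1) :=
  [set i : 'I_r.+1 | (i <= minn p.1 p.2)%N]%SET.
pose sq p := finset.setX (le_min p) (le_min p).
(* The dummy [true] gives the shape of [pair_big_dep], which fibres the count over [(x, y)]. *)
rewrite (eq_bigl (fun q => true && (q.2 \in sq q.1))).
  rewrite -(pair_big_dep xpredT (fun p k => k \in sq p) (fun _ _ => 1%N)).
  apply: eq_bigr => -[x y] _ /=.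
  by rewrite sum1_card cardsX card_ord_leq ?mulnn // gtn_min ltn_ord.
by move=> q; rewrite !inE.
Qed.

Local Open Scope ring_scope.

(** Line sums [r] force the five entries off the corners. *)
Definition corner_mx (r : nat) (q : 'I_r.+1 * 'I_r.+1 * ('I_r.+1 * 'I_r.+1)) :
    'M[int]_3 :=
  let: ((x, y), (a, w)) := q in
  \matrix_(i, j) nth 0 (nth [::] [::
    [:: a%:Z; x%:Z - a%:Z; r%:Z - x%:Z];
    [:: y%:Z - a%:Z; r%:Z + w%:Z - x%:Z - y%:Z + a%:Z; x%:Z - w%:Z];
    [:: r%:Z - y%:Z; y%:Z - w%:Z; w%:Z]] i) j.

Lemma corner_mx_inj r : injective (@corner_mx r).
Proof.
move=> [[x y] [a w]] [[x' y'] [a' w']] /matrixP eqA.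
have := (eqA 0 0, eqA 0 2%:R, eqA 2%:R 0, eqA 2%:R 2%:R).
rewrite !mxE /= => -[[[e1 e2] e3] e4].
by congr (_, _, (_, _)); apply: val_inj => /=; lia.
Qed.

Lemma big_ord3 (F : 'I_3 -> int) : \sum_(i < 3) F i = F 0 + F 1 + F 2%:R.
Proof.
rewrite !big_ord_recl big_ord0 addr0 addrA.
by congr (_ + F _ + F _); apply: val_inj.
Qed.

Lemma ASM3_corners r : ASM3 r = @corner_mx r @` [set` corners r].
Proof.
have ord3 (i : 'I_3) : [\/ i = 0, i = 1 | i = 2%:R].
  by case: i => [[|[|[|//]]] i3]; [apply: Or31|apply: Or32|apply: Or33];
     apply: val_inj.
apply/seteqP; split=> [A | _ [[[x y] [a w]] + <-]]; last first.
  rewrite /= inE /= !leq_min => /andP[/andP[ax ay] /andP[wx wy]].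
  have [xr yr] := (ltn_ord x, ltn_ord y).
  by split=> i j; rewrite ?(big_mkcond (fun _ => leq _ _)) !big_ord3;
    case: (ord3 i) => ->; case: (ord3 j) => ->; rewrite /= !mxE /=; lia.
case=> sumA rl rr cl cr.
have [[r0 c0] [r1 c1] [r2 c2]] := And3 (sumA 0 0) (sumA 1 1) (sumA 2%:R 2%:R).
(* Partial sums with a single term: all entries but the central one are nonnegative. *)
have [A00 A01 A02] := And3 (cl 0 0 isT) (cl 0 1 isT) (cl 0 2%:R isT).
have [A20 A21 A22] := And3 (cr 2%:R 0 isT) (cr 2%:R 1 isT) (cr 2%:R 2%:R isT).
have [A10 A12] := (rl 1 0 isT, rr 1 2%:R isT).
move: r0 c0 r1 c1 r2 c2 A00 A01 A02 A20 A21 A22 A10 A12.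
rewrite !(big_mkcond (fun _ => leq _ _)) !big_ord3 /= !addr0 !add0r.
move=> r0 c0 r1 c1 r2 c2 A00 A01 A02 A20 A21 A22 A10 A12.
pose o (z : int) : 'I_r.+1 := inord `|z|%N.
have oE z : 0 <= z <= r%:Z -> o z = z :> int by move=> zr; rewrite inordK; lia.
exists (o (r%:Z - A 0 2%:R), o (r%:Z - A 2%:R 0), (o (A 0 0), o (A 2%:R 2%:R))).
  (* The four bounds by [x] and [y] amount to nonnegativity of the entries midway along the
     sides. *)
  rewrite /= inE /= !leq_min -!lez_nat !oE; lia.
apply/matrixP=> i j; rewrite !mxE !oE; try lia.
by case: (ord3 i) => ->; case: (ord3 j) => -> /=; lia.
Qed.

Theorem mainTheorem3 (r : nat) :
  ASM3 r #= `I_('C(r + 2, 4) + 2 * 'C(r + 3, 4) + 'C(r + 4, 4))%N.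
Proof.
rewrite -card_corners ASM3_corners.
rewrite (card_eql (inj_card_eq _)) ?card_eq_finset //.
by move=> p q _ _; apply: corner_mx_inj.
Qed.
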